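(* Let $A, B \in \mathcal{C}_2(\mathcal{H})$ and let $0\leq \nu \leq 1$. Then $$\|A+B\|_{2} \leq \sqrt{2\,w_{(2,\nu)}^2\left(\begin{bmatrix} 0 & A \\ B^* & 0 \end{bmatrix}\right) - (1-2\nu)^2\|A-B\|_{2}^2} \leq \|A\|_{2} + \|B\|_{2}.$$
   Context: $\mathcal{H}$ is a complex Hilbert space. For a complex Hilbert space $\mathcal{K}$, $\mathcal{C}_2(\mathcal{K})$ is the Hilbert--Schmidt class, i.e. the bounded linear operators $T$ on $\mathcal{K}$ with $\|T\|_2=\sqrt{\mathrm{tr}(T^*T)}<\infty$. For $0\leq\nu\leq1$ and $T\in\mathcal{C}_2(\mathcal{K})$, define $$w_{(2,\nu)}(T)=\sup_{\theta\in\mathbb{R}}\left\|\nu e^{i\theta}T+(1-\nu)e^{-i\theta}T^*\right\|_2,$$ and $w_{(2,\nu)}^2(T)$ means $\left(w_{(2,\nu)}(T)\right)^2$. The $2\times2$ operator matrix acts on $\mathcal{H}\oplus\mathcal{H}$, and $w_{(2,\nu)}$ of it is taken with $\mathcal{K}=\mathcal{H}\oplus\mathcal{H}$. *)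

(* Defs.v *)
From HB Require Import structures.
From mathcomp Require Import all_boot all_order all_algebra.
From mathcomp Require Import sesquilinear complex ring.
From mathcomp Require Import all_classical all_reals all_analysis.

Set Implicit Arguments.
Unset Strict Implicit.
Unset Printing Implicit Defensive.

Import Order.TTheory GRing.Theory Num.Theory.
Import numFieldNormedType.Exports.

Local Open Scope classical_set_scope.
Local Open Scope complex_scope.
Local Open Scope ring_scope.

(* The inner product is linear in its first argument and conjugate-linear in
   the second one. *)
HB.mixin Record CompleteNormedModule_isHilbert (R : realType) H
    & CompleteNormedModule R[i] H := {
  inner : {dot H for (@Num.conj R[i])} ;
  sqr_norm_inner : forall x : H, `|x| ^+ 2 = inner x x
}.

#[short(type="hilbertType")]
HB.structure Definition Hilbert (R : realType) :=
  {H of CompleteNormedModule R[i] H & CompleteNormedModule_isHilbert R H}.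

(* The library puts the sup norm on H * K, so the Hilbert direct sum is an
   alias of this type, with its own norm. *)
Definition dsum (H K : Type) : Type := (H * K)%type.

Lemma sqrtC_sum_sqr_triangle (C : numClosedFieldType) (a b c d : C) :
  0 <= a -> 0 <= b -> 0 <= c -> 0 <= d ->
  sqrtC ((a + c) ^+ 2 + (b + d) ^+ 2) <=
  sqrtC (a ^+ 2 + b ^+ 2) + sqrtC (c ^+ 2 + d ^+ 2).
Proof.
move=> a0 b0 c0 d0.
have ge0 (x y : C) : 0 <= x -> 0 <= y -> 0 <= x ^+ 2 + y ^+ 2.
  by move=> x0 y0; rewrite addr_ge0// exprn_ge0.
rewrite -ler_sqr ?nnegrE ?addr_ge0 ?sqrtC_ge0 ?ge0 ?addr_ge0//.
rewrite sqrtCK.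
move: (sqrtCK (a ^+ 2 + b ^+ 2)) (sqrtCK (c ^+ 2 + d ^+ 2)).
move: (sqrtC_ge0 (a ^+ 2 + b ^+ 2)) (sqrtC_ge0 (c ^+ 2 + d ^+ 2)).
rewrite !ge0//; move: (sqrtC (a ^+ 2 + _)) (sqrtC (c ^+ 2 + _)).
move=> s t s0 t0 sE tE.
rewrite [X in _ <= X]sqrrD sE tE -subr_ge0.
rewrite (_ : _ - _ = (s * t - (a * c + b * d)) *+ 2); last by ring.
rewrite mulrn_wge0// subr_ge0 -ler_sqr ?nnegrE; first last.
- by rewrite mulr_ge0.
- by rewrite addr_ge0 ?mulr_ge0.
rewrite exprMn sE tE -subr_ge0.
have -> : (a ^+ 2 + b ^+ 2) * (c ^+ 2 + d ^+ 2) - (a * c + b * d) ^+ 2 =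
    (a * d - b * c) ^+ 2 by ring.
by rewrite real_exprn_even_ge0// realB// ger0_real// mulr_ge0.
Qed.

Section direct_sum.
Variables (R : realType) (H K : hilbertType R).

HB.instance Definition _ := GRing.Lmodule.copy (dsum H K) (H * K)%type.

Definition dsum_norm (x : dsum H K) : R[i] :=
  sqrtC (`|x.1| ^+ 2 + `|x.2| ^+ 2).

Let dsum_sqr_ge0 (x : dsum H K) : 0 <= `|x.1| ^+ 2 + `|x.2| ^+ 2.
Proof. by rewrite addr_ge0// exprn_ge0. Qed.

Let dsum_ler_normD (x y : dsum H K) :
  dsum_norm (x + y) <= dsum_norm x + dsum_norm y.
Proof.
apply: le_trans (sqrtC_sum_sqr_triangle _ _ _ _) => //.
rewrite ler_sqrtC ?qualifE/= ?addr_ge0 ?exprn_ge0 ?addr_ge0//.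
by rewrite lerD// ler_sqr ?nnegrE ?addr_ge0 ?ler_normD.
Qed.

Let dsum_normrZ (l : R[i]) (x : dsum H K) :
  dsum_norm (l *: x) = `|l| * dsum_norm x.
Proof.
rewrite /dsum_norm /= !normrZ !exprMn -mulrDr sqrtCM ?nnegrE ?exprn_ge0//.
by rewrite sqrCK.
Qed.

Let dsum_normr0_eq0 (x : dsum H K) : dsum_norm x = 0 -> x = 0.
Proof.
move/eqP; rewrite sqrtC_eq0 paddr_eq0 ?exprn_ge0// !sqrf_eq0 !normr_eq0.
by case: x => x y /= /andP[/eqP-> /eqP->].
Qed.

HB.instance Definition _ := Lmodule_isNormed.Build R[i] (dsum H K)
  dsum_ler_normD dsum_normrZ dsum_normr0_eq0.

Let dsum_norm_fst (x : dsum H K) : `|x.1| <= `|x|.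
Proof.
rewrite -ler_sqr ?nnegrE// [X in _ <= X ^+ 2]/Num.norm /= sqrtCK.
by rewrite lerDl exprn_ge0.
Qed.

Let dsum_norm_snd (x : dsum H K) : `|x.2| <= `|x|.
Proof.
rewrite -ler_sqr ?nnegrE// [X in _ <= X ^+ 2]/Num.norm /= sqrtCK.
by rewrite lerDr exprn_ge0.
Qed.

Let dsum_norm_le (x : dsum H K) : `|x| <= `|x.1| + `|x.2|.
Proof.
rewrite -ler_sqr ?nnegrE ?addr_ge0// [X in X ^+ 2 <= _]/Num.norm /= sqrtCK.
by rewrite sqrrD addrAC lerDl mulrn_wge0// mulr_ge0.
Qed.

Let dsum_cauchy_cvg (F : set_system (dsum H K)) :
  ProperFilter F -> cauchy F -> cvg F.
Proof.
move=> FF /cauchyP Fc.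
have Fc1 : cvg ((fun x : dsum H K => x.1) @ F).
  apply: cauchy_cvg; apply/cauchyP => e e0; have [x Fx] := Fc e e0.
  have xH (y : dsum H K) : ball x e y -> ball x.1 e y.1.
    by rewrite -!ball_normE /=; apply: le_lt_trans (dsum_norm_fst (x - y)).
  by exists x.1; exact: filterS xH Fx.
have Fc2 : cvg ((fun x : dsum H K => x.2) @ F).
  apply: cauchy_cvg; apply/cauchyP => e e0; have [x Fx] := Fc e e0.
  have xH (y : dsum H K) : ball x e y -> ball x.2 e y.2.
    by rewrite -!ball_normE /=; apply: le_lt_trans (dsum_norm_snd (x - y)).
  by exists x.2; exact: filterS xH Fx.
move/cvg_ex : Fc1 => [l1 /cvgrPdist_lt Fl1].
move/cvg_ex : Fc2 => [l2 /cvgrPdist_lt Fl2].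
apply/cvg_ex; exists ((l1, l2) : dsum H K).
apply/fcvgrPdist_lt => e e0; rewrite !near_simpl.
have e20 : 0 < e / 2 by rewrite divr_gt0.
near=> x; apply: le_lt_trans (dsum_norm_le _) _.
by rewrite [e]splitr ltrD//=; near: x; [exact: Fl1|exact: Fl2].
Unshelve. all: by end_near. Qed.

HB.instance Definition _ := Uniform_isComplete.Build (dsum H K) dsum_cauchy_cvg.

Definition dsum_inner (x y : dsum H K) : R[i] :=
  inner x.1 y.1 + inner x.2 y.2.

Let dsum_inner_bilinear :
  bilinear_for (GRing.Scale.Law.clone _ _ ( *%R ) _)
               (GRing.Scale.Law.clone _ _ ((@Num.conj R[i]) \; *%R) _)
               dsum_inner.
Proof.
split=> [u a x y|u a x y]; rewrite /dsum_inner /=.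
  by rewrite !linearPl mulrDr addrACA.
by rewrite !linearPr /= mulrDr addrACA.
Qed.

HB.instance Definition _ := bilinear_isBilinear.Build R[i] (dsum H K) (dsum H K)
  R[i] _ _ dsum_inner dsum_inner_bilinear.

Let dsum_inner_herm (x y : dsum H K) :
  dsum_inner x y = (-1) ^+ false * Num.conj (dsum_inner y x).
Proof.
rewrite /dsum_inner rmorphD mulrDr.
by rewrite [inner x.1 _]hermC [inner x.2 _]hermC.
Qed.

HB.instance Definition _ := isHermitianSesquilinear.Build R[i] (dsum H K)
  false Num.conj dsum_inner dsum_inner_herm.

Let dsum_sqr_norm_inner (x : dsum H K) : `|x| ^+ 2 = dsum_inner x x.
Proof.
by rewrite [X in X ^+ 2]/Num.norm /= sqrtCK /dsum_inner !sqr_norm_inner.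
Qed.

Let dsum_inner_gt0 (x : dsum H K) : x != 0 -> 0 < dsum_inner x x.
Proof. by move=> x0; rewrite -dsum_sqr_norm_inner exprn_gt0// normr_gt0. Qed.

HB.instance Definition _ := isDotProduct.Build R[i] (dsum H K)
  dsum_inner dsum_inner_gt0.

HB.instance Definition _ := CompleteNormedModule_isHilbert.Build R (dsum H K)
  dsum_sqr_norm_inner.

End direct_sum.

Section operators.
Variables (R : realType) (H : hilbertType R).
Implicit Types (E : set H) (T : H -> H).

Definition bounded_operator T :=
  linear T /\ exists M, forall x, `|T x| <= M * `|x|.

(* Well defined for bounded operators, by the Riesz representation theorem. *)
Definition adjoint T : H -> H :=
  fun y => xget 0 [set z | forall x, inner (T x) y = inner x z].

Definition orthonormal_set E :=
  forall x y, E x -> E y -> inner x y = (x == y)%:R.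

Definition orthonormal_basis E :=
  orthonormal_set E /\
  forall F, orthonormal_set F -> E `<=` F -> F = E.

Lemma orthonormal_basis_ex : exists E, orthonormal_basis E.
Proof.
have [|E [oE maxE]] := @Zorn_bigcup H orthonormal_set.
  move=> F FP Ftot x y [A FA Ax] [B FB By].
  have [AB|BA] := Ftot _ _ FA FB.
    by apply: (FP _ FB) => //; exact: AB.
  by apply: (FP _ FA) => //; exact: BA.
exists E; split=> // F oF EF; apply: contrapT => FE.
apply: (maxE F) => //; split=> // FE'; apply: FE.
by apply/seteqP; split.
Qed.

Definition orthonormal_basis_of : set H := projT1 (cid orthonormal_basis_ex).

(* The trace of a positive operator; its diagonal coefficients are nonnegative
   reals and their sum does not depend on the orthonormal basis. *)
Definition pos_trace T : \bar R :=
  (\esum_(e in orthonormal_basis_of) (complex.Re (inner (T e) e))%:E)%E.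

Definition hilbert_schmidt T :=
  bounded_operator T /\ (pos_trace (adjoint T \o T) < +oo)%E.

Definition hs_norm T : R := Num.sqrt (fine (pos_trace (adjoint T \o T))).

Definition expi (theta : R) : R[i] := cos theta +i* sin theta.

Definition w2nu (nu : R) T : R :=
  sup [set hs_norm ((nu%:C * expi theta) *: T +
                    ((1 - nu)%:C * expi (- theta)) *: adjoint T)
      | theta in [set: R]].

Definition opmx (A B C D : H -> H) : dsum H H -> dsum H H :=
  fun x => (A x.1 + B x.2, C x.1 + D x.2).

End operators.

(* Main.v *)
Require Import Defs.
From mathcomp Require Import all_boot all_order all_algebra.
From mathcomp Require Import sesquilinear complex ring lra.
From mathcomp Require Import all_classical all_reals all_analysis.

(** The square of the Hilbert-Schmidt norm of an off-diagonal operator matrix is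
    the sum of the squares of the norms of its two entries, and taking adjoints
    preserves this norm.  Hence the square of the norm of the rotated
    combination of angle theta is
      ||c A + d B||^2 + ||c^* B + d^* A||^2
    where |c| = nu and |d| = 1 - nu.

    At theta = 0 the two terms are nu A + (1 - nu) B and nu B + (1 - nu) A,
    whose sum is A + B and whose difference is (2 nu - 1) (A - B).  By the
    parallelogram law, twice the square is
    ||A + B||^2 + (1 - 2 nu)^2 ||A - B||^2, and the supremum is at least this
    value: this is the first inequality.

    For every theta, the triangle inequality bounds the square by
    (nu a + (1 - nu) b)^2 + (nu b + (1 - nu) a)^2 with a = ||A|| and b = ||B||.
    By the same parallelogram law, for scalars, twice this bound is
    (a + b)^2 + (1 - 2 nu)^2 (a - b)^2; since |a - b| <= ||A - B||, subtracting
    (1 - 2 nu)^2 ||A - B||^2 leaves at most (a + b)^2: this is the second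
    inequality.  No inner product of operators is involved.

    The Hilbert space theory behind these facts is developed from completeness:
    projection onto the closure of a subspace ([orthogonal_projection]), which
    gives both the Riesz representation theorem, hence adjoints ([adjointP]),
    and Parseval's identity for a maximal orthonormal set ([parseval]).
    Parseval's identity yields the invariance of the Hilbert-Schmidt norm under
    adjoints ([hs_energy_adjoint]) by an exchange of sums; as this holds for
    maps between two different spaces, it also computes the norm on the direct
    sum ([hs_energy_offdiag]). *)

Set Implicit Arguments.
Unset Strict Implicit.
Unset Printing Implicit Defensive.

Import Order.TTheory GRing.Theory Num.Theory.
Import numFieldNormedType.Exports.

Local Open Scope classical_set_scope.
Local Open Scope complex_scope.
Local Open Scope ring_scope.

(** * Inner products through squared norms *)

Definition sqmod (R : realType) (z : R[i]) : R :=
  complex.Re z ^+ 2 + complex.Im z ^+ 2.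

(** The norm of a Hilbert space takes its values in the complex numbers; its
    square, as a real number, is what enters sums and infima below. *)
Definition sqnorm (R : realType) (H : hilbertType R) (x : H) : R :=
  complex.Re (inner x x).

Section sqmod.
Variable R : realType.
Implicit Types (z w : R[i]) (r : R).

Lemma sqmodC z : (sqmod z)%:C = z * Num.conj z.
Proof. by rewrite /sqmod add_Re2_Im2 normCK. Qed.

Lemma sqmod_ge0 z : 0 <= sqmod z.
Proof. by rewrite addr_ge0// sqr_ge0. Qed.

Lemma sqmod0 : sqmod (0 : R[i]) = 0.
Proof. by rewrite /sqmod /= expr0n addr0. Qed.

Lemma sqmod_eq0 z : sqmod z = 0 -> z = 0.
Proof.
move=> /(congr1 (real_complex R)); rewrite /sqmod add_Re2_Im2.
by move=> /eqP; rewrite sqrf_eq0 normr_eq0 => /eqP.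
Qed.

Lemma sqmodM z w : sqmod (z * w) = sqmod z * sqmod w.
Proof.
by case: z => a b; case: w => c d; rewrite /sqmod; simpc => /=; ring.
Qed.

Lemma sqmod_conj z : sqmod (Num.conj z) = sqmod z.
Proof.
by apply: complexI; rewrite !sqmodC conjCK mulrC.
Qed.

Lemma sqmod_real r : sqmod r%:C = r ^+ 2.
Proof. by rewrite /sqmod /= expr0n addr0. Qed.

Lemma sqmod_le2D z w : sqmod (z + w) <= 2 * sqmod z + 2 * sqmod w.
Proof.
case: z => a b; case: w => c d; rewrite /sqmod /=.
have := sqr_ge0 (a - c); have := sqr_ge0 (b - d); lra.
Qed.

End sqmod.

Section inner_product.
Variables (R : realType) (H : hilbertType R).
Implicit Types (x y u v : H) (c : R[i]).

Lemma inner_conj x y : inner x y = Num.conj (inner y x).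
Proof. by rewrite hermC expr0 mul1r. Qed.

Lemma innerZl c x y : inner (c *: x) y = c * inner x y.
Proof. exact: linearZl_LR. Qed.

Lemma innerZr c x y : inner x (c *: y) = Num.conj c * inner x y.
Proof. exact: linearZr_LR. Qed.

Lemma sqnormC x : (sqnorm x)%:C = inner x x.
Proof. by rewrite /sqnorm RRe_real// -sqr_norm_inner realX// normr_real. Qed.

Lemma sqnorm_normr x : (sqnorm x)%:C = `|x| ^+ 2.
Proof. by rewrite sqnormC sqr_norm_inner. Qed.

Lemma sqnorm_ge0 x : 0 <= sqnorm x.
Proof. by rewrite -ler0c sqnorm_normr exprn_ge0. Qed.

Lemma sqnorm_eq0 x : sqnorm x = 0 -> x = 0.
Proof.
move=> /(congr1 (real_complex R)); rewrite sqnorm_normr => /eqP.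
by rewrite sqrf_eq0 normr_eq0 => /eqP.
Qed.

Lemma sqnorm0 : sqnorm (0 : H) = 0.
Proof. by rewrite /sqnorm linear0l. Qed.

Lemma sqnormZ c x : sqnorm (c *: x) = sqmod c * sqnorm x.
Proof.
apply: complexI; rewrite [RHS]rmorphM /= !sqnormC sqmodC innerZl innerZr.
by rewrite mulrA.
Qed.

Lemma sqnormN x : sqnorm (- x) = sqnorm x.
Proof. by rewrite /sqnorm hnormN. Qed.

Lemma sqnormD x y :
  sqnorm (x + y) = sqnorm x + sqnorm y + 2 * complex.Re (inner x y).
Proof.
rewrite /sqnorm linearDl /= !linearDr /= [inner y x]inner_conj.
move: (inner x x) (inner x y) (inner y y) => [a b] [c d] [e f].
by simpc => /=; ring.
Qed.

Lemma sqnormB x y : sqnorm (x - y) = sqnorm (y - x).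
Proof. by rewrite -sqnormN opprB. Qed.

Lemma parallelogram x y :
  sqnorm (x + y) + sqnorm (x - y) = 2 * sqnorm x + 2 * sqnorm y.
Proof. rewrite !sqnormD sqnormN linearNr raddfN /=; ring. Qed.

(** The coefficient [c = inner x v / sqnorm v] minimizes [sqnorm (x - c *: v)],
    with minimum [sqnorm x - sqmod (inner x v) / sqnorm v].  For [d = 0] this
    is the Cauchy-Schwarz inequality; when [d] is the squared distance from [x]
    to a subspace that contains [v], it says that an almost closest point
    leaves an almost orthogonal residual. *)
Lemma sqmod_inner_le d x v : (forall c, d <= sqnorm (x - c *: v)) ->
  sqmod (inner x v) <= (sqnorm x - d) * sqnorm v.
Proof.
move=> dle; have [v0|v0] := eqVneq (sqnorm v) 0.
  by rewrite (sqnorm_eq0 v0) linear0r sqmod0 sqnorm0 mulr0.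
have vgt0 : 0 < sqnorm v by rewrite lt_def v0 sqnorm_ge0.
rewrite -ler_pdivrMr// lerBrDr addrC -lerBrDr.
apply: le_trans (dle ((sqnorm v)^-1%:C * inner x v)) _.
rewrite sqnormD sqnormN sqnormZ sqmodM sqmod_real.
rewrite linearNr /= innerZr.
have -> : Num.conj ((sqnorm v)^-1%:C * inner x v) * inner x v =
    ((sqnorm v)^-1 * sqmod (inner x v))%:C.
  rewrite rmorphM /= [RHS]rmorphM /= sqmodC [in RHS]mulrCA mulrC.
  by congr (_ * (_ * _)); exact: conjc_real.
rewrite /=.
rewrite le_eqVlt; apply/orP; left; apply/eqP; field; exact: v0.
Qed.

Lemma cauchy_schwarz x y : sqmod (inner x y) <= sqnorm x * sqnorm y.
Proof.
by rewrite -[sqnorm x]subr0; apply: sqmod_inner_le => c; exact: sqnorm_ge0.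
Qed.

End inner_product.

(** * Orthogonal projection, Riesz representation and adjoints *)

Section projection.
Variables (R : realType) (H : hilbertType R).
Implicit Types (x y u v : H) (c : R[i]).

Lemma normr_ltC x (r : R) : 0 < r -> (`|x| < r%:C) = (sqnorm x < r ^+ 2).
Proof.
move=> r0; rewrite -[RHS]ltcR sqnorm_normr rmorphXn /=.
by rewrite ltr_sqr ?nnegrE// ler0c ltW.
Qed.

Lemma sqnorm_cauchy_cvg (w : nat -> H) (a : nat -> R) :
  (forall n m, sqnorm (w n - w m) <= a n + a m) ->
  (forall e : R, 0 < e -> \forall n \near \oo, a n < e) ->
  exists z, forall e : R, 0 < e -> \forall n \near \oo, sqnorm (z - w n) < e.
Proof.
move=> wa a0.
have : cvg (w @ \oo).
  apply: cauchy_cvg; apply/cauchyP => e e0.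
  have eE : e = (complex.Re e)%:C by rewrite RRe_real// gtr0_real.
  have r0 : 0 < complex.Re e by rewrite -ltcR -eE.
  have r2 : 0 < complex.Re e ^+ 2 / 2 by rewrite divr_gt0// exprn_gt0.
  have [N _ aN] := a0 _ r2; exists (w N).
  exists N => //= n Nn; rewrite -ball_normE /= eE normr_ltC//.
  apply: le_lt_trans (wa _ _) _.
  by rewrite [ltRHS]splitr ltrD//; apply: aN => /=.
move/cvg_ex => [z /cvgrPdist_lt wz]; exists z => e e0.
have se0 : 0 < Num.sqrt e by rewrite sqrtr_gt0.
have /wz : 0 < (Num.sqrt e)%:C by rewrite ltcR.
by apply: filterS => n /=; rewrite normr_ltC// sqr_sqrtr// ltW.
Qed.

(** The subspace [V] need not be closed: [z] lies in its closure.  By the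
    parallelogram law a sequence of [V] that minimizes the distance to [x] is
    Cauchy, and [z] is its limit; orthogonality comes from [sqmod_inner_le],
    applied to the terms of the sequence. *)
Lemma orthogonal_projection (V : set H) x :
  V 0 -> (forall u v c, V u -> V v -> V (u + c *: v)) ->
  exists z, (forall e : R, 0 < e -> exists2 w, V w & sqnorm (z - w) < e) /\
    forall v, V v -> inner (x - z) v = 0.
Proof.
move=> V0 VP; pose D := [set sqnorm (x - v) | v in V]; pose d := inf D.
have Dinf : has_inf D.
  split; first by exists (sqnorm (x - 0)), 0.
  by exists 0 => _ [v _ <-]; exact: sqnorm_ge0.
have dle v : V v -> d <= sqnorm (x - v).
  by move=> Vv; apply: ge_inf; [case: Dinf|exists v].
have wex n : exists w, V w /\ sqnorm (x - w) < d + n.+1%:R^-1.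
  have [|_ [w Vw <-] ?] := @inf_adherent _ D (n.+1%:R^-1) _ Dinf.
    by rewrite invr_gt0.
  by exists w.
(* The midpoint of [w n] and [w m] lies in [V], hence at squared distance at
   least [d] from [x]; the parallelogram law then bounds
   [sqnorm (w n - w m)] by [2 / n.+1 + 2 / m.+1]. *)
have [w wP] := choice wex.
have [n m||z wz] := @sqnorm_cauchy_cvg w (fun n => 2 * n.+1%:R^-1).
- have [Vn dn] := wP n; have [Vm dm] := wP m.
  have /dle : V (2^-1 *: (w n + w m)).
    rewrite -[_ *: _]add0r; apply: (VP) => //; rewrite -[w m]scale1r.
    exact: VP.
  have := parallelogram (x - w n) (x - w m).
  have -> : x - w n - (x - w m) = w m - w n by rewrite opprB addrC addrA subrK.
  rewrite [sqnorm (w m - _)]sqnormB.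
  have -> : x - w n + (x - w m) = (2%:R : R)%:C *: (x - 2^-1 *: (w n + w m)).
    rewrite scalerBr scalerA rmorph_nat mulfV ?pnatr_eq0// scale1r.
    by rewrite scaler_nat mulr2n opprD addrACA.
  rewrite sqnormZ sqmod_real.
  by move: dn dm; set a := _^-1; set b := _^-1; lra.
- move=> e e0; have e20 : 0 < e / 2 by rewrite divr_gt0.
  near=> n; rewrite mulrC -ltr_pdivlMr//.
  by near: n; exact: near_infty_natSinv_lt (PosNum e20).
exists z; split=> [e /wz [n _ /(_ n (leqnn n)) ?]|v Vv].
  by exists (w n) => //; case: (wP n).
apply: sqmod_eq0; apply/eqP; rewrite eq_le sqmod_ge0 andbT.
apply/ler_addgt0Pl => /= e e0; rewrite addr0.
have v0 := sqnorm_ge0 v.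
have [k k0 kE] : exists2 k : R, 0 < k & k * (sqnorm v + 1) = e / 4.
  exists (e / 4 / (sqnorm v + 1)); first by rewrite !divr_gt0// ltr_wpDl.
  by rewrite divfK// gt_eqF// ltr_wpDl.
near \oo => n.
have nk : n.+1%:R^-1 < k.
  by near: n; exact: near_infty_natSinv_lt (PosNum k0).
have wk : sqnorm (z - w n) < k by near: n; exact: wz.
have [Vn dn] := wP n.
(* The first part of the residual is almost orthogonal to [v], the second one
   is small; [k] makes the two contributions add up to at most [e]. *)
have -> : x - z = (x - w n) + (w n - z) by rewrite addrA subrK.
rewrite linearDl /=; apply: le_trans (sqmod_le2D _ _) _.
have h1 : sqmod (inner (x - w n) v) <= n.+1%:R^-1 * sqnorm v.
  apply: (@le_trans _ _ ((sqnorm (x - w n) - d) * sqnorm v)).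
    apply: sqmod_inner_le => c; rewrite -addrA -opprD; apply: dle.
    exact: VP.
  by rewrite ler_wpM2r ?sqnorm_ge0// lerBlDl ltW.
have := cauchy_schwarz (w n - z) v; rewrite sqnormB => h2.
have h3 := ler_wpM2r v0 (ltW nk); have h4 := ler_wpM2r v0 (ltW wk).
rewrite mulrDr mulr1 in kE.
have := le_trans h1 h3; have := le_trans h2 h4; move: kE (ltW k0).
move: (sqmod _) (sqmod _) (k * _) => a b f.
lra.
Unshelve. all: by end_near. Qed.

(** A nonzero [f] is determined by its kernel and by one value.  The residual
    [u] of the projection of some [x0], [f x0 <> 0], onto the kernel is
    orthogonal to it, and [x - (f x / f u) *: u] is in the kernel for all [x];
    taking the inner product with [u] gives [f x]. *)
Lemma riesz (f : H -> R[i]) (K : R) : scalar f ->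
  (forall x, sqmod (f x) <= K * sqnorm x) -> exists z, forall x, f x = inner x z.
Proof.
move=> flin fK.
have f0 : f 0 = 0.
  by have := flin (-1) 0 0; rewrite scaler0 addr0 mulN1r addNr.
have [[x0 fx0]|nf] := pselect (exists x, f x <> 0); last first.
  exists 0 => x; rewrite linear0r; apply: contrapT => fx.
  by apply: nf; exists x.
have [u v c /= fu fv|p [pV xp]] := @orthogonal_projection [set x | f x = 0] x0 f0.
  by rewrite addrC flin fu fv mulr0 addr0.
have K0 : 0 <= K.
  rewrite leNgt; apply/negP => Kn; apply: fx0; apply: sqmod_eq0.
  apply/eqP; rewrite eq_le sqmod_ge0 andbT; apply: le_trans (fK _) _.
  by rewrite nmulr_rle0 ?sqnorm_ge0.
have fB x y : f (x - y) = f x - f y.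
  by rewrite addrC -scaleN1r flin mulN1r addrC.
have fp : f p = 0.
  apply: sqmod_eq0; apply/eqP; rewrite eq_le sqmod_ge0 andbT.
  apply/ler_addgt0Pl => /= e e0; rewrite addr0.
  have k0 : 0 < e / (K + 1) by rewrite divr_gt0// ltr_wpDl.
  have [w /= fw pw] := pV _ k0.
  have := fK (p - w); rewrite fB fw subr0 => /le_trans; apply.
  apply: (@le_trans _ _ (K * (e / (K + 1)))); first by rewrite ler_wpM2l// ltW.
  rewrite mulrCA ger_pMr// ler_pdivrMr ?ltr_wpDl//; lra.
pose u := x0 - p; have fu : f u != 0.
  by rewrite fB fp subr0; apply/eqP.
have uu0 : inner u u != 0.
  apply/eqP; rewrite -sqnormC => uu.
  move: fu; rewrite (@sqnorm_eq0 _ _ u) ?f0 ?eqxx//.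
  exact: complexI uu.
exists (Num.conj (f u / inner u u) *: u) => x.
have : inner (x - (f x / f u) *: u) u = 0.
  rewrite inner_conj xp ?conjC0//=.
  by rewrite fB -[_ *: u]addr0 flin f0 addr0 divfK// subrr.
rewrite linearBl /= innerZl innerZr conjCK => /eqP; rewrite subr_eq0 => /eqP ->.
by field; apply/andP.
Qed.

End projection.

(** A pair of formal adjoints, between possibly different spaces.  This
    relation is symmetric and stable under sums, multiples and composition,
    and it is all that the computations of Hilbert-Schmidt norms use. *)
Definition adjoint_pair (R : realType) (H K : hilbertType R)
    (T : H -> K) (S : K -> H) :=
  forall x y, inner (T x) y = inner x (S y).

Section adjoint.
Variables (R : realType) (H K L : hilbertType R).

Lemma adjoint_pair_sym (T : H -> K) (S : K -> H) :
  adjoint_pair T S -> adjoint_pair S T.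
Proof. by move=> TS x y; rewrite inner_conj -TS -inner_conj. Qed.

Lemma adjoint_pair_comp (T : H -> K) (S : K -> H) (T' : K -> L) (S' : L -> K) :
  adjoint_pair T S -> adjoint_pair T' S' -> adjoint_pair (T' \o T) (S \o S').
Proof. by move=> TS TS' x y /=; rewrite TS' TS. Qed.

Lemma adjoint_pairD (T T' : H -> K) (S S' : K -> H) :
  adjoint_pair T S -> adjoint_pair T' S' -> adjoint_pair (T + T') (S + S').
Proof.
by move=> TS TS' x y; rewrite !fctE linearDl linearDr /= TS TS'.
Qed.

Lemma adjoint_pairZ c (T : H -> K) (S : K -> H) :
  adjoint_pair T S -> adjoint_pair (c *: T) (Num.conj c *: S).
Proof. by move=> TS x y; rewrite !fctE innerZl innerZr conjCK TS. Qed.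

Lemma inner_inj (x y : H) : (forall z, inner z x = inner z y) -> x = y.
Proof.
move=> xy; apply/eqP; rewrite -subr_eq0; apply/eqP/sqnorm_eq0.
by rewrite /sqnorm [inner _ (x - y)]linearBr /= xy subrr.
Qed.

Lemma adjoint_pair_eq (T S : H -> H) : adjoint_pair T S -> adjoint T = S.
Proof.
move=> TS; apply/funext => y; rewrite /adjoint.
case: xgetP => [z _ /= zP|/(_ (S y)) /= []]; last by move=> x; exact: TS.
by apply: inner_inj => x; rewrite -zP TS.
Qed.

(** Riesz representation applied to [fun x => inner (T x) y] for every [y]. *)
Lemma adjointP (T : H -> H) : bounded_operator T -> adjoint_pair T (adjoint T).
Proof.
move=> [Tlin [M TM]].
have TM' x : sqnorm (T x) <= sqmod M * sqnorm x.
  rewrite -lecR rmorphM /= !sqnorm_normr /sqmod add_Re2_Im2 -exprMn.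
  rewrite ler_sqr ?nnegrE ?mulr_ge0//; apply: le_trans (TM x) _.
  rewrite -[leLHS]ger0_norm ?normrM ?normr_id//.
  exact: le_trans (TM x).
suff [S TS] : exists S, adjoint_pair T S by rewrite (adjoint_pair_eq TS).
suff : forall y, exists z, forall x, inner (T x) y = inner x z.
  by move=> /choice [S SP]; exists S => x y; exact: SP.
move=> y; apply: (@riesz _ _ (fun x => inner (T x) y) (sqmod M * sqnorm y)).
  by move=> a u v; rewrite /= Tlin linearPl.
move=> x; apply: le_trans (cauchy_schwarz _ _) _.
by rewrite mulrAC ler_wpM2r ?sqnorm_ge0.
Qed.

End adjoint.

(** * Sums of nonnegative families *)

Section esum_complements.
Variable R : realType.

Lemma esumZl (T : choiceType) (I : set T) (a : T -> \bar R) (r : R) :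
  0 <= r -> (forall i, (0 <= a i)%E) ->
  (\esum_(i in I) (r%:E * a i) = r%:E * \esum_(i in I) a i)%E.
Proof.
move=> r0 a0; rewrite /esum -ereal_supZl//; last first.
  apply/set0P; exists (\sum_(x \in set0) a x)%R; exists set0 => //.
  exact: fsets_set0.
congr ereal_sup; rewrite image_comp; apply: eq_imagel => X _ /=.
by rewrite ge0_mule_fsumr.
Qed.

Lemma esum_interchange (T T' : choiceType) (P : set T) (Q : set T')
    (a : T -> T' -> \bar R) : (forall i j, (0 <= a i j)%E) ->
  \esum_(i in P) \esum_(j in Q) a i j = \esum_(j in Q) \esum_(i in P) a i j.
Proof.
move=> a0; rewrite !esum_esum//.
rewrite (reindex_esum (Q `*` P) _ (fun x => (x.2, x.1)))//; split=> //=.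
- by move=> [i j] [/=].
- by move=> [i1 i2] [j1 j2] /= _ _ [] -> ->.
- by move=> [i1 i2] [Pi1 Qi2] /=; exists (i2, i1).
Qed.

End esum_complements.

(** * Parseval's identity for maximal orthonormal sets *)

Section parseval.
Variables (R : realType) (H : hilbertType R).
Implicit Types (x y : H) (E : set H).

Definition fourier_sum x (s : seq H) : H := \sum_(e <- s) inner x e *: e.

Lemma fourier_sum_orthogonal E x (s : seq H) : orthonormal_set E -> uniq s ->
  {subset s <= E} -> forall e, e \in s -> inner (x - fourier_sum x s) e = 0.
Proof.
move=> oE us sE e es.
have sE' f : f \in s -> E f by move=> /sE /set_mem.
rewrite linearBl /= linear_sumlz (bigD1_seq e)//= innerZl.
rewrite [inner e e]oE ?eqxx ?mulr1; [|exact: sE'..].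
rewrite big_seq_cond big1 ?addr0 ?subrr// => f /andP[fs fe].
by rewrite innerZl [inner f e]oE ?(negPf fe) ?mulr0//; exact: sE'.
Qed.

Lemma fourier_sum_residual E x (s : seq H) : orthonormal_set E -> uniq s ->
  {subset s <= E} -> inner (x - fourier_sum x s) (fourier_sum x s) = 0.
Proof.
move=> oE us sE; rewrite {2}/fourier_sum linear_sumr big_seq big1// => e es /=.
by rewrite innerZr (fourier_sum_orthogonal x oE us sE) ?mulr0.
Qed.

Lemma fourier_sum_sqnorm E x (s : seq H) : orthonormal_set E -> uniq s ->
  {subset s <= E} ->
  sqnorm x = sqnorm (x - fourier_sum x s) + \sum_(e <- s) sqmod (inner x e).
Proof.
move=> oE us sE; have := fourier_sum_residual x oE us sE.
set p := fourier_sum x s => xpp.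
rewrite -{1}[x](subrK p) [LHS]sqnormD xpp mulr0 addr0; congr (_ + _).
apply: complexI; rewrite sqnormC rmorph_sum /=.
move/eqP: xpp; rewrite linearBl subr_eq0 => /eqP <-.
rewrite linear_sumr; apply: eq_bigr => e _.
by rewrite /= innerZr sqmodC mulrC.
Qed.

(** The Fourier sum over [s] is the closest point to [x] in the span of [s]. *)
Lemma best_approximation E x (s : seq H) (l : seq (R[i] * H)) :
  orthonormal_set E -> uniq s -> {subset s <= E} ->
  {in l, forall p, p.2 \in s} ->
  sqnorm x - \sum_(e <- s) sqmod (inner x e) <=
    sqnorm (x - \sum_(p <- l) p.1 *: p.2).
Proof.
move=> oE us sE ls; have orth := fourier_sum_orthogonal x oE us sE.
rewrite {1}(fourier_sum_sqnorm x oE us sE) addrK.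
set p := fourier_sum x s in orth *; set v := \sum_(_ <- l) _.
have -> : x - v = (x - p) + (p - v) by rewrite addrA subrK.
rewrite [leRHS]sqnormD linearBr /=.
rewrite (fourier_sum_residual x oE us sE).
have -> : inner (x - p) v = 0.
  rewrite linear_sumr big_seq big1// => q ql /=.
  by rewrite innerZr orth ?mulr0 ?ls.
by rewrite subrr mulr0 addr0 lerDl sqnorm_ge0.
Qed.

(** Otherwise the normalization of [x] could be added to [E], against
    maximality. *)
Lemma orthonormal_basis_complete E x : orthonormal_basis E ->
  (forall e, E e -> inner x e = 0) -> x = 0.
Proof.
move=> [oE maxE] xE; apply: contrapT => x0.
have nx0 : sqnorm x != 0 by apply/eqP => /sqnorm_eq0.
have nx_gt0 : 0 < sqnorm x by rewrite lt_def nx0 sqnorm_ge0.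
pose u := (Num.sqrt (sqnorm x))^-1%:C *: x.
have nu1 : inner u u = 1.
  rewrite -sqnormC sqnormZ sqmod_real exprVn sqr_sqrtr ?ltW// mulVf//.
have uE e : E e -> inner u e = 0 by move=> Ee; rewrite innerZl xE ?mulr0.
have Eu e : E e -> inner e u = 0 by move=> Ee; rewrite inner_conj uE ?conjC0.
have uNE e : E e -> e != u.
  move=> Ee; apply/eqP => eu; have := uE _ Ee.
  by rewrite eu nu1 => /eqP; rewrite oner_eq0.
suff EuE : E `|` [set u] = E.
  have /uNE : E u by rewrite -EuE; right.
  by rewrite eqxx.
apply: maxE; last by move=> e; left.
move=> e f [Ee|->] [Ef|->]; first exact: oE.
- by rewrite Eu// (negPf (uNE _ Ee)).
- by rewrite uE// eq_sym (negPf (uNE _ Ef)).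
- by rewrite nu1 eqxx.
Qed.

(** Bessel's inequality gives one direction.  For the other one, [x] minus its
    projection onto the span [V] of [E] is orthogonal to [E], so it vanishes
    and [x] is a limit of finite combinations of [E]; Fourier sums are better
    approximations than these, so their squared norms come arbitrarily close
    to that of [x]. *)
Lemma parseval E x : orthonormal_basis E ->
  \esum_(e in E) (sqmod (inner x e))%:E = (sqnorm x)%:E.
Proof.
move=> bE; have [oE _] := bE; apply/eqP; rewrite eq_le; apply/andP; split.
  apply: ge_ereal_sup => _ [X [finX XE] <-].
  rewrite fsumEFin// lee_fin fsbig_finite//=.
  have sE : {subset finmap.enum_fset (fset_set X) <= E}.
    by move=> e; rewrite in_fset_set// => /set_mem /XE /mem_set.
  rewrite [leRHS](fourier_sum_sqnorm x oE (finmap.fset_uniq _) sE).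
  by rewrite lerDr sqnorm_ge0.
pose V := [set v | exists l : seq (R[i] * H),
  {in l, forall p, E p.2} /\ v = \sum_(p <- l) p.1 *: p.2].
have VE e : E e -> V e.
  move=> Ee; exists [:: (1, e)]; split; last by rewrite big_seq1 scale1r.
  by move=> p; rewrite inE => /eqP ->.
have [||z [zV xz]] := @orthogonal_projection _ _ V x.
- by exists [::]; rewrite big_nil.
- move=> _ _ c [l [lE ->]] [l' [lE' ->]].
  exists (l ++ [seq (c * p.1, p.2) | p <- l']); split.
    move=> p; rewrite mem_cat => /orP[/lE//|/mapP[q /lE' Eq ->//]].
  rewrite big_cat big_map scaler_sumr /=; congr (_ + _).
  by apply: eq_bigr => p _; rewrite scalerA.
have xE : x = z.
  apply/eqP; rewrite -subr_eq0; apply/eqP.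
  by apply: (orthonormal_basis_complete bE) => e /VE /xz.
apply/lee_addgt0Pr => /= e /zV [_ [l [lE ->]]]; rewrite -xE => xl.
pose s := undup [seq p.2 | p <- l].
have sE : {subset s <= E}.
  by move=> f; rewrite mem_undup => /mapP[p /lE Ep ->]; exact: mem_set.
have ls : {in l, forall p, p.2 \in s}.
  by move=> p pl; rewrite mem_undup map_f.
have := best_approximation x oE (undup_uniq _) sE ls.
rewrite lerBlDr => /le_lt_trans - /(_ (e + \sum_(f <- s) sqmod (inner x f))).
rewrite ltrD2r => /(_ xl) xs.
apply: (@le_trans _ _ (\sum_(f <- s) sqmod (inner x f) + e)%:E).
  by rewrite lee_fin addrC ltW.
rewrite EFinD leeD2r//; apply: esum_ge; exists [set` s].
  by split; [exact: finite_seq|move=> f /= /sE /set_mem].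
by rewrite fsumEFin; [rewrite -fsbig_seq// undup_uniq|exact: finite_seq].
Qed.

End parseval.

(** * The sum of the squared norms of the images of a basis *)

Section energy.
Variables (R : realType) (H K : hilbertType R).
Implicit Types T X Y : H -> K.

(** The square of the Hilbert-Schmidt norm, as an extended real number, for
    maps between possibly different spaces. *)
Definition hs_energy T : \bar R :=
  \esum_(e in @orthonormal_basis_of R H) (sqnorm (T e))%:E.

Lemma hs_energy_ge0 T : (0 <= hs_energy T)%E.
Proof. by apply: esum_ge0 => e _; rewrite lee_fin sqnorm_ge0. Qed.

Lemma hs_energyZ c T : (hs_energy (c *: T) = (sqmod c)%:E * hs_energy T)%E.
Proof.
rewrite /hs_energy -esumZl ?sqmod_ge0//; last first.
  by move=> e; rewrite lee_fin sqnorm_ge0.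
by apply: eq_esum => e _; rewrite fctE sqnormZ EFinM.
Qed.

Lemma hs_energy_parallelogram X Y :
  (hs_energy (X + Y)%R + hs_energy (X - Y)%R =
   2%:E * hs_energy X + 2%:E * hs_energy Y)%E.
Proof.
have sq0 (T : H -> K) e : (0 <= (sqnorm (T e))%:E)%E.
  by rewrite lee_fin sqnorm_ge0.
have sq20 (T : H -> K) e : (0 <= 2%:E * (sqnorm (T e))%:E)%E.
  by rewrite mule_ge0.
rewrite /hs_energy -!esumZl// -!esumD//.
apply: eq_esum => e _; rewrite !fctE -!EFinM -!EFinD.
by rewrite parallelogram.
Qed.

(** The substitute for Minkowski's inequality: optimizing over [t] gives the
    triangle inequality for the square root of the energy.  Pointwise, the
    difference of the two sides is [sqnorm (t *: X e - Y e) / t]. *)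
Lemma hs_energyD_le X Y (t : R) : 0 < t ->
  (hs_energy (X + Y)%R <=
   (1 + t)%:E * hs_energy X + (1 + t^-1)%:E * hs_energy Y)%E.
Proof.
move=> t0; have [t1 t1'] : 0 <= 1 + t /\ 0 <= 1 + t^-1.
  by rewrite !addr_ge0// ?invr_ge0 ltW.
have sq0 (T : H -> K) e : (0 <= (sqnorm (T e))%:E)%E.
  by rewrite lee_fin sqnorm_ge0.
rewrite /hs_energy -!esumZl// -!esumD; try by move=> e _; rewrite mule_ge0.
apply: le_esum => e _; rewrite -!EFinM -EFinD lee_fin fctE.
rewrite sqnormD -subr_ge0.
have := sqnorm_ge0 (t%:C *: X e - Y e).
rewrite sqnormD sqnormN sqnormZ sqmod_real linearNr /= innerZl.
have -> : complex.Re (- (t%:C * inner (X e) (Y e))) =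
    - (t * complex.Re (inner (X e) (Y e))).
  by case: (inner _ _) => a b; simpc.
move=> h; rewrite -(pmulr_rge0 _ t0); apply: le_trans h _.
rewrite le_eqVlt; apply/orP; left; apply/eqP; field; exact: lt0r_neq0.
Qed.

End energy.

Lemma orthonormal_basis_ofP (R : realType) (H : hilbertType R) :
  orthonormal_basis (@orthonormal_basis_of R H).
Proof. exact: (projT2 (cid (orthonormal_basis_ex H))). Qed.

(** Expand each [T e] by Parseval in the other basis, exchange the sums, and
    recognize the coefficients of [S f].  It also makes the energy independent
    of the basis, so the basis selected in a direct sum never has to be
    related to the one selected in its summands. *)
Lemma hs_energy_adjoint (R : realType) (H K : hilbertType R)
  (T : H -> K) (S : K -> H) : adjoint_pair T S -> hs_energy T = hs_energy S.
Proof.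
move=> TS; rewrite /hs_energy.
under eq_esum => e _ do rewrite -(parseval _ (orthonormal_basis_ofP K)).
rewrite esum_interchange; last by move=> e f; rewrite lee_fin sqmod_ge0.
apply: eq_esum => f _; rewrite -(parseval _ (orthonormal_basis_ofP H)).
by apply: eq_esum => e _; rewrite TS inner_conj sqmod_conj.
Qed.

Lemma pos_trace_adjoint (R : realType) (H : hilbertType R) (T S : H -> H) :
  adjoint_pair T S -> pos_trace (adjoint T \o T) = hs_energy T.
Proof.
move=> TS; rewrite (adjoint_pair_eq TS); apply: eq_esum => e _ /=.
by rewrite (adjoint_pair_sym TS).
Qed.

(** * Hilbert-Schmidt operators and their norm *)

Definition hs_operator (R : realType) (H K : hilbertType R) (T : H -> K) :=
  (exists S, adjoint_pair T S) /\ (hs_energy T < +oo)%E.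

Section hs_operator.
Variables (R : realType) (H K : hilbertType R).
Implicit Types X Y : H -> K.

Lemma hs_operatorZ c X : hs_operator X -> hs_operator (c *: X).
Proof.
move=> [[S XS] Xoo]; split.
  by exists (Num.conj c *: S); exact: adjoint_pairZ.
by rewrite hs_energyZ lte_mul_pinfty// lee_fin sqmod_ge0.
Qed.

Lemma hs_operatorD X Y : hs_operator X -> hs_operator Y -> hs_operator (X + Y).
Proof.
move=> [[S XS] Xoo] [[S' YS'] Yoo]; split.
  by exists (S + S'); exact: adjoint_pairD.
apply: le_lt_trans (hs_energyD_le X Y ltr01) _.
by rewrite lte_add_pinfty// lte_mul_pinfty// lee_fin addr_ge0// invr_ge0.
Qed.

Lemma hs_operatorB X Y : hs_operator X -> hs_operator Y -> hs_operator (X - Y).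
Proof.
move=> hX hY; rewrite -[- Y]scaleN1r; apply: hs_operatorD => //.
exact: hs_operatorZ.
Qed.

End hs_operator.

Section hs_norm.
Variables (R : realType) (H : hilbertType R).
Implicit Types (X Y : H -> H) (c : R[i]).

Lemma hilbert_schmidt_hs_operator X : hilbert_schmidt X -> hs_operator X.
Proof.
move=> [bX Xoo]; have XX := adjointP bX; split; first by exists (adjoint X).
by rewrite -(pos_trace_adjoint XX).
Qed.

Lemma hs_norm_ge0 X : 0 <= hs_norm X.
Proof. exact: sqrtr_ge0. Qed.

Lemma hs_norm_sqr X : hs_operator X -> (hs_norm X ^+ 2)%:E = hs_energy X.
Proof.
move=> [[S XS] Xoo]; rewrite /hs_norm (pos_trace_adjoint XS).
rewrite sqr_sqrtr ?fine_ge0 ?hs_energy_ge0// fineK//.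
by rewrite ge0_fin_numE ?hs_energy_ge0.
Qed.

Lemma hs_normZ c X : hs_operator X ->
  hs_norm (c *: X) = Num.sqrt (sqmod c) * hs_norm X.
Proof.
move=> hX; apply/eqP; rewrite -(@eqrXn2 _ 2) ?mulr_ge0 ?sqrtr_ge0//.
rewrite exprMn (sqr_sqrtr (sqmod_ge0 c)); apply/eqP/EFin_inj.
by rewrite [RHS]EFinM !hs_norm_sqr ?hs_energyZ//; exact: hs_operatorZ.
Qed.

Lemma hs_norm_parallelogram X Y : hs_operator X -> hs_operator Y ->
  hs_norm (X + Y) ^+ 2 + hs_norm (X - Y) ^+ 2 =
  2 * hs_norm X ^+ 2 + 2 * hs_norm Y ^+ 2.
Proof.
move=> hX hY; have := hs_energy_parallelogram X Y.
rewrite -!hs_norm_sqr//; [|exact: hs_operatorB|exact: hs_operatorD].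
by rewrite -!EFinM -!EFinD => -[].
Qed.

(** [hs_energyD_le] at [t = b / a], the optimal ratio for the bounds [a] and
    [b] on the two norms. *)
Lemma hs_norm_triangle X Y : hs_operator X -> hs_operator Y ->
  hs_norm (X + Y) <= hs_norm X + hs_norm Y.
Proof.
move=> hX hY; have X0 := hs_norm_ge0 X; have Y0 := hs_norm_ge0 Y.
have le_t (t : R) : 0 < t -> hs_norm (X + Y) ^+ 2 <=
    (1 + t) * hs_norm X ^+ 2 + (1 + t^-1) * hs_norm Y ^+ 2.
  move=> t0; have := hs_energyD_le X Y t0.
  rewrite -!hs_norm_sqr//; last exact: hs_operatorD.
apply/ler_addgt0Pl => /= e e0.
(* The shift by [e / 2] keeps [a] and [b] positive when a norm vanishes. *)
pose a := hs_norm X + e / 2; pose b := hs_norm Y + e / 2.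
have e20 : 0 < e / 2 by rewrite divr_gt0.
have a0 : 0 < a by rewrite ltr_wpDl.
have b0 : 0 < b by rewrite ltr_wpDl.
have -> : e + (hs_norm X + hs_norm Y) = a + b by rewrite /a /b; field.
rewrite -ler_sqr ?nnegrE ?hs_norm_ge0 ?(ltW (addr_gt0 a0 b0))//.
apply: le_trans (le_t (b / a) (divr_gt0 b0 a0)) _.
have -> : (a + b) ^+ 2 = (1 + b / a) * a ^+ 2 + (1 + (b / a)^-1) * b ^+ 2.
  by field; rewrite !gt_eqF.
have le_ab (c d r : R) : 0 <= c -> 0 < r -> c <= d ->
    (1 + r) * c ^+ 2 <= (1 + r) * d ^+ 2.
  move=> c0 r0 cd; apply: ler_wpM2l; first by rewrite addr_ge0// ltW.
  by rewrite ler_sqr// nnegrE (le_trans c0).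
by rewrite lerD// le_ab// ?invr_gt0 ?divr_gt0// lerDl ltW.
Qed.

End hs_norm.

(** * Off-diagonal operator matrices *)

Section offdiagonal.
Variables (R : realType) (H : hilbertType R).
Implicit Types (A B S T : H -> H) (c d : R[i]).

Lemma inner_dsum (x y : dsum H H) : inner x y = inner x.1 y.1 + inner x.2 y.2.
Proof. by []. Qed.

Lemma sqnorm_dsum (x : dsum H H) : sqnorm x = sqnorm x.1 + sqnorm x.2.
Proof. by apply: complexI; rewrite rmorphD /= !sqnormC inner_dsum. Qed.

Lemma adjoint_pair_fst :
  adjoint_pair (fun x : dsum H H => x.1) (fun y : H => (y, 0) : dsum H H).
Proof. by move=> x y; rewrite inner_dsum linear0r addr0. Qed.

Lemma adjoint_pair_snd :
  adjoint_pair (fun x : dsum H H => x.2) (fun y : H => (0, y) : dsum H H).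
Proof. by move=> x y; rewrite inner_dsum linear0r add0r. Qed.

(** The adjoint of [A \o fst] is [S] followed by an isometric embedding, so
    both sides equal the energy of [S]. *)
Lemma hs_energy_fst A S : adjoint_pair A S ->
  hs_energy (A \o (fun x : dsum H H => x.1)) = hs_energy A.
Proof.
move=> AS; rewrite (hs_energy_adjoint (adjoint_pair_comp adjoint_pair_fst AS)).
rewrite (hs_energy_adjoint AS); apply: eq_esum => e _ /=.
by rewrite sqnorm_dsum /= sqnorm0 addr0.
Qed.

Lemma hs_energy_snd A S : adjoint_pair A S ->
  hs_energy (A \o (fun x : dsum H H => x.2)) = hs_energy A.
Proof.
move=> AS; rewrite (hs_energy_adjoint (adjoint_pair_comp adjoint_pair_snd AS)).
rewrite (hs_energy_adjoint AS); apply: eq_esum => e _ /=.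
by rewrite sqnorm_dsum /= sqnorm0 add0r.
Qed.

Lemma adjoint_pair_offdiag A S B T : adjoint_pair A S -> adjoint_pair B T ->
  adjoint_pair (opmx 0 A T 0) (opmx 0 B S 0).
Proof.
move=> AS BT x y; rewrite !inner_dsum /= !add0r !addr0.
by rewrite AS (adjoint_pair_sym BT) addrC.
Qed.

Lemma hs_energy_offdiag A S B T : adjoint_pair A S -> adjoint_pair B T ->
  hs_energy (opmx 0 A B 0) = (hs_energy A + hs_energy B)%E.
Proof.
move=> AS BT; rewrite -(hs_energy_snd AS) -(hs_energy_fst BT) -esumD.
- by apply: eq_esum => e _; rewrite sqnorm_dsum /= ?add0r ?addr0.
- by move=> e _; rewrite lee_fin sqnorm_ge0.
- by move=> e _; rewrite lee_fin sqnorm_ge0.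
Qed.

Lemma hs_operator_offdiag A B : hs_operator A -> hs_operator B ->
  hs_operator (opmx 0 A B 0).
Proof.
move=> [[S AS] Aoo] [[T BT] Boo]; split; last first.
  by rewrite (hs_energy_offdiag AS BT) lte_add_pinfty.
by exists (opmx 0 T S 0); apply: adjoint_pair_offdiag => //; exact: adjoint_pair_sym.
Qed.

Lemma offdiag_comb c d A B S T :
  c *: opmx 0 A T 0 + d *: opmx 0 B S 0 =
  opmx 0 (c *: A + d *: B) (c *: T + d *: S) 0.
Proof.
apply/funext => x; rewrite /opmx !fctE !add0r !addr0.
by [].
Qed.

(** The lower left entry is turned into its adjoint, which does not change its
    norm; this is what conjugates [c] and [d]. *)
Lemma hs_norm_offdiag_comb c d A B S T :
  hs_operator A -> hs_operator B -> adjoint_pair A S -> adjoint_pair B T ->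
  hs_norm (c *: opmx 0 A T 0 + d *: opmx 0 B S 0) ^+ 2 =
  hs_norm (c *: A + d *: B) ^+ 2 +
  hs_norm (Num.conj c *: B + Num.conj d *: A) ^+ 2.
Proof.
move=> hA hB AS BT; have [SA TB] := (adjoint_pair_sym AS, adjoint_pair_sym BT).
have AB := adjoint_pairD (adjoint_pairZ c AS) (adjoint_pairZ d BT).
have TS := adjoint_pairD (adjoint_pairZ c TB) (adjoint_pairZ d SA).
have hAB : hs_operator (c *: A + d *: B).
  by apply: hs_operatorD; exact: hs_operatorZ.
have hBA : hs_operator (Num.conj c *: B + Num.conj d *: A).
  by apply: hs_operatorD; exact: hs_operatorZ.
have hTS : hs_operator (c *: T + d *: S).
  split; first by exists (Num.conj c *: B + Num.conj d *: A).
  by rewrite (hs_energy_adjoint TS); case: hBA.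
apply: EFin_inj; rewrite offdiag_comb EFinD !hs_norm_sqr//.
- by rewrite (hs_energy_offdiag AB TS) -(hs_energy_adjoint TS).
- exact: hs_operator_offdiag.
Qed.

End offdiagonal.

(** * The rotated combinations and the two inequalities *)

Lemma hs_norm_combination_le (R : realType) (H : hilbertType R) (A B : H -> H)
    (c d : R[i]) (r s : R) : hs_operator A -> hs_operator B ->
  0 <= r -> 0 <= s -> sqmod c = r ^+ 2 -> sqmod d = s ^+ 2 ->
  hs_norm (c *: A + d *: B) <= r * hs_norm A + s * hs_norm B.
Proof.
move=> hA hB r0 s0 cr ds.
have := hs_norm_triangle (hs_operatorZ c hA) (hs_operatorZ d hB).
by rewrite !hs_normZ// cr ds !sqrtr_sqr !ger0_norm.
Qed.

Section weighted_radius.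
Variables (R : realType) (H : hilbertType R) (A B : H -> H) (nu : R).
Hypotheses (hA : hilbert_schmidt A) (hB : hilbert_schmidt B).
Hypothesis hnu : 0 <= nu <= 1.

Let T := opmx 0 A (adjoint B) 0.
Let a := hs_norm A.
Let b := hs_norm B.

Let hsA : hs_operator A. Proof. exact: hilbert_schmidt_hs_operator. Qed.
Let hsB : hs_operator B. Proof. exact: hilbert_schmidt_hs_operator. Qed.

Definition rotated_norm theta :=
  hs_norm ((nu%:C * expi theta) *: T +
           ((1 - nu)%:C * expi (- theta)) *: adjoint T).

Lemma sqmod_expi (theta : R) : sqmod (expi theta) = 1.
Proof. exact: cos2Dsin2. Qed.

Lemma rotated_norm_sqr theta :
  let c := nu%:C * expi theta in let d := (1 - nu)%:C * expi (- theta) in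
  rotated_norm theta ^+ 2 = hs_norm (c *: A + d *: B) ^+ 2 +
                            hs_norm (Num.conj c *: B + Num.conj d *: A) ^+ 2.
Proof.
move=> c d; have [AA BB] := (adjointP hA.1, adjointP hB.1).
rewrite /rotated_norm /T (adjoint_pair_eq (adjoint_pair_offdiag AA BB)).
exact: hs_norm_offdiag_comb.
Qed.

Lemma rotated_norm_le theta : rotated_norm theta <=
  Num.sqrt ((nu * a + (1 - nu) * b) ^+ 2 + (nu * b + (1 - nu) * a) ^+ 2).
Proof.
have /andP[nu0 nu1] := hnu; have nu1' : 0 <= 1 - nu by rewrite subr_ge0.
have sqE (r t : R) : sqmod (r%:C * expi t) = r ^+ 2.
  by rewrite sqmodM sqmod_real sqmod_expi mulr1.
have le_sqr (x y : R) : 0 <= x -> x <= y -> x ^+ 2 <= y ^+ 2.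
  by move=> x0 xy; rewrite ler_sqr// nnegrE (le_trans x0).
rewrite -[leLHS]ger0_norm ?hs_norm_ge0// -sqrtr_sqr ler_wsqrtr//.
rewrite rotated_norm_sqr lerD// le_sqr ?hs_norm_ge0//.
  by apply: hs_norm_combination_le.
by apply: hs_norm_combination_le; rewrite ?sqmod_conj.
Qed.

(** With [X = nu A + (1 - nu) B] and [Y = nu B + (1 - nu) A] one has
    [X + Y = A + B] and [X - Y = (2 nu - 1) (A - B)], so this is the
    parallelogram law for [X] and [Y]. *)
Lemma rotated_norm0_sqr : 2 * rotated_norm 0 ^+ 2 =
  hs_norm (A + B) ^+ 2 + (1 - 2 * nu) ^+ 2 * hs_norm (A - B) ^+ 2.
Proof.
have e1 : expi 0 = 1 :> R[i] by rewrite /expi cos0 sin0.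
rewrite rotated_norm_sqr oppr0 e1 !mulr1 !conj_Creal ?complex_real ?eqxx//.
set X := nu%:C *: A + _; set Y := nu%:C *: B + _.
have hsX : hs_operator X by apply: hs_operatorD; exact: hs_operatorZ.
have hsY : hs_operator Y by apply: hs_operatorD; exact: hs_operatorZ.
rewrite mulrDr -hs_norm_parallelogram//.
have XY : X + Y = A + B.
  rewrite /X /Y [nu%:C *: B + _]addrC addrACA -!scalerDl -rmorphD /=.
  by rewrite -rmorphD /= subrKC subrK !scale1r.
have YX : X - Y = (2 * nu - 1)%:C *: (A - B).
  have -> : (2 * nu - 1)%:C = nu%:C - (1 - nu)%:C.
    by rewrite -rmorphB /=; congr _%:C; ring.
  by rewrite scalerBr !scalerBl opprB opprD [- _ - _]addrC addrACA.
rewrite XY YX hs_normZ; last exact: hs_operatorB.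
rewrite sqmod_real sqrtr_sqr exprMn real_normK ?num_real//.
by rewrite -[(1 - _) ^+ 2]sqrrN opprB.
Qed.

Lemma rotated_norm_has_sup :
  has_sup [set rotated_norm theta | theta in [set: R]].
Proof.
split; first by exists (rotated_norm 0), 0.
exists (Num.sqrt ((nu * a + (1 - nu) * b) ^+ 2 + (nu * b + (1 - nu) * a) ^+ 2)).
by move=> _ [theta _ <-]; exact: rotated_norm_le.
Qed.

Lemma w2nu_ge : rotated_norm 0 <= w2nu nu T.
Proof. by apply: ub_le_sup; [case: rotated_norm_has_sup|exists 0]. Qed.

Lemma w2nu_sqr_le : w2nu nu T ^+ 2 <=
  (nu * a + (1 - nu) * b) ^+ 2 + (nu * b + (1 - nu) * a) ^+ 2.
Proof.
set M := (X in _ <= X); have M0 : 0 <= M by rewrite addr_ge0// sqr_ge0.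
have w0 : 0 <= w2nu nu T by apply: le_trans w2nu_ge; exact: hs_norm_ge0.
rewrite -(sqr_sqrtr M0) ler_sqr ?nnegrE ?sqrtr_ge0//.
apply: ge_sup; first by case: rotated_norm_has_sup.
by move=> _ [theta _ <-]; exact: rotated_norm_le.
Qed.

End weighted_radius.

Theorem theorem4p2 (R : realType) (H : hilbertType R) (A B : H -> H) (nu : R)
  (hA : hilbert_schmidt A) (hB : hilbert_schmidt B) (hnu : 0 <= nu <= 1) :
  hs_norm (A + B) <=
    Num.sqrt (2 * w2nu nu (opmx 0 A (adjoint B) 0) ^+ 2
              - (1 - 2 * nu) ^+ 2 * hs_norm (A - B) ^+ 2)
  /\
  Num.sqrt (2 * w2nu nu (opmx 0 A (adjoint B) 0) ^+ 2
            - (1 - 2 * nu) ^+ 2 * hs_norm (A - B) ^+ 2)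
    <= hs_norm A + hs_norm B.
Proof.
have [sA sB] := (hilbert_schmidt_hs_operator hA, hilbert_schmidt_hs_operator hB).
split.
  rewrite -[leLHS]ger0_norm ?hs_norm_ge0// -sqrtr_sqr ler_wsqrtr// lerBrDr.
  rewrite -rotated_norm0_sqr// ler_wpM2l// ler_sqr ?nnegrE ?hs_norm_ge0//.
    exact: w2nu_ge.
  by apply: le_trans (w2nu_ge hA hB hnu); exact: hs_norm_ge0.
have a0 := hs_norm_ge0 A; have b0 := hs_norm_ge0 B.
rewrite -[leRHS]ger0_norm ?addr_ge0// -sqrtr_sqr ler_wsqrtr//.
have dist : (hs_norm A - hs_norm B) ^+ 2 <= hs_norm (A - B) ^+ 2.
  rewrite -[leLHS]real_normK ?num_real// ler_sqr ?nnegrE ?hs_norm_ge0//.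
  have := hs_norm_triangle (hs_operatorB sA sB) sB; rewrite subrK => hAB.
  have := hs_norm_triangle (hs_operatorB sB sA) sA; rewrite subrK.
  rewrite -[B - A]opprB -scaleN1r hs_normZ; last exact: hs_operatorB.
  have -> : sqmod (-1 : R[i]) = 1.
    by rewrite /sqmod /= sqrrN expr1n oppr0 expr0n addr0.
  by rewrite sqrtr1 mul1r ler_norml; lra.
have := w2nu_sqr_le hA hB hnu; have := ler_wpM2l (sqr_ge0 (1 - 2 * nu)) dist.
(* With a = hs_norm A and b = hs_norm B, the two bounds combine through
   2 (nu a + (1 - nu) b)^2 + 2 (nu b + (1 - nu) a)^2
     = (a + b)^2 + (1 - 2 nu)^2 (a - b)^2,
   the scalar form of the parallelogram law used for the lower bound. *)
move: (w2nu _ _ ^+ 2) (_ * hs_norm (A - B) ^+ 2) => w d; nra.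
Qed.
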